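(* Let $n\ge2$, let $\alpha,\beta\in\mathbb R^n$ each have pairwise distinct coordinates, and let $u,v\in\mathbb R^n$. The form $h_{u\oplus v}(x,y,t)$ splits into $n$ real linear factors if and only if there exist $a,b,c\in\mathbb R$ such that $$u=a\mathbf 1_n+c\,\alpha^\circ,\qquad v=b\mathbf 1_n+c\,\beta^\circ .$$
   Context: Finite free additive convolution: for $p(x)=\sum_{k=0}^n(-1)^ka_kx^{n-k}$ and $q(x)=\sum_{k=0}^n(-1)^kb_kx^{n-k}$ with $a_0=b_0=1$, set $(p\boxplus_n q)(x)=\sum_{k=0}^n(-1)^kc_kx^{n-k}$ with $c_k=\sum_{i+j=k}\frac{(n-i)!(n-j)!}{n!(n-k)!}a_ib_j$. For $\alpha\in\mathbb R^n$, $P_\alpha(x)=\prod_{i=1}^n(x-\alpha_i)$. For $w=u\oplus v$, $h_w(x,y,t)=\mathcal F_n(x,\,y\alpha+tu,\,y\beta+tv)$, where $\mathcal F_n(x,\zeta,\eta)=(P_\zeta\boxplus_nP_\eta)(x)$; it is a real homogeneous polynomial of degree $n$ in $(x,y,t)$. $\mathbf 1_n$ is the all-ones vector in $\mathbb R^n$. For $\rho\in\mathbb R^n$, $\bar\rho=\frac1n\sum_i\rho_i$ and $\rho^\circ=\rho-\bar\rho\,\mathbf 1_n$. *)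

(* Defs.v *)
From HB Require Import structures.
From mathcomp Require Import all_boot all_order all_algebra.
From mathcomp Require Import reals.
From mathcomp Require Import mpoly.

Set Implicit Arguments.
Unset Strict Implicit.
Unset Printing Implicit Defensive.

Import GRing.Theory.
Local Open Scope ring_scope.

(* Convolution and products are defined over a commutative F-algebra A, so that
   they can be used both with real numbers (A = R^o) and with indeterminates
   (A = {mpoly R[3]}). *)
Section FiniteFree.
Variables (F : fieldType) (A : comAlgType F).

(* The number a_k in p = \sum_(k <= n) (-1)^k a_k x^(n-k). *)
Definition signed_coef (n : nat) (p : {poly A}) (k : nat) : A :=
  (-1) ^+ k * p`_(n - k).

Definition ffconv_weight (n i j : nat) : F :=
  ((n - i)`! * (n - j)`!)%:R / (n`! * (n - (i + j))`!)%:R.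

Definition ffconv_coef (n : nat) (p q : {poly A}) (k : nat) : A :=
  \sum_(i < k.+1)
    ffconv_weight n i (k - i) *: (signed_coef n p i * signed_coef n q (k - i)).

(* Intended for p and q monic of degree n. *)
Definition ffconv (n : nat) (p q : {poly A}) : {poly A} :=
  \sum_(k < n.+1) ((-1) ^+ k * ffconv_coef n p q k) *: 'X^(n - k).

Definition root_poly (n : nat) (z : 'rV[A]_n) : {poly A} :=
  \prod_(i < n) ('X - (z 0 i)%:P).

Definition ffconv_roots (n : nat) (x : A) (z e : 'rV[A]_n) : A :=
  (ffconv n (root_poly z) (root_poly e)).[x].

End FiniteFree.

Section Form.
Variables (R : realType) (n : nat).

Definition varx : {mpoly R[3]} := 'X_(@Ordinal 3 0 isT).
Definition vary : {mpoly R[3]} := 'X_(@Ordinal 3 1 isT).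
Definition vart : {mpoly R[3]} := 'X_(@Ordinal 3 2 isT).

(* The vector y * a + t * u, with entries in R[x, y, t]. *)
Definition pencil (a u : 'rV[R]_n) : 'rV[{mpoly R[3]}]_n :=
  \row_i (a 0 i *: vary + u 0 i *: vart).

Definition hform (alpha beta u v : 'rV[R]_n) : {mpoly R[3]} :=
  ffconv_roots varx (pencil alpha u) (pencil beta v).

(* A zero factor is allowed by [dhomog], but is excluded when h != 0. *)
Definition splits_linear (m : nat) (h : {mpoly R[3]}) : Prop :=
  exists L : 'I_m -> {mpoly R[3]},
    (forall i, L i \is 1.-homog) /\ h = \prod_(i < m) L i.

Definition ones : 'rV[R]_n := const_mx 1.

Definition mean (rho : 'rV[R]_n) : R := n%:R^-1 * \sum_(i < n) rho 0 i.

Definition centered (rho : 'rV[R]_n) : 'rV[R]_n := rho - mean rho *: ones.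

End Form.

Arguments ones {R n}.

(* Main.v *)
Require Import Defs.
From mathcomp Require Import all_boot all_order all_algebra.
From mathcomp Require Import reals boolp ring lra zify complex mpoly.

(* The convolution of prod (X - a_i) and prod (X - b_j) at z is, up to n!, the
   permanent of the matrix (z - a_i - b_j).  Hence h depends on the pencils only
   through translations and scalings when u and v have the stated form, and then
   it splits because the convolution of real-rooted polynomials is real-rooted
   (Grace and Walsh).

   Conversely, let h be a product of factors x - g_i y - d_i t.  The main tool is
   that a multiple root of the convolution of p and q is rare: a root of
   multiplicity m >= 2 forces p and q to have roots whose multiplicities add up
   to at least n + m.  Since alpha and beta are injective, the g_i are therefore
   distinct, and each pair of factors collides at one point (y : 1), where
   clusters of y alpha + u and y beta + v have total size at least n + 2.  At two
   different points y, clusters of the same pencil share at most one index, so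
   that their sizes add up to at most n + 1 for each of the two pencils; as
   2 (n + 2) > 2 (n + 1), all collisions happen at the same y.  There the
   convolution is an n-th power, so that y alpha + u and y beta + v are constant
   vectors. *)

Set Implicit Arguments.
Unset Strict Implicit.
Unset Printing Implicit Defensive.

Import Order.TTheory GRing.Theory Num.Theory.
Local Open Scope ring_scope.

(** * Convolution and permanents *)

Section RootProducts.
Variable A : comNzRingType.
Implicit Types (s t : seq A).

Definition prodX s : {poly A} := \prod_(a <- s) ('X - a%:P).

Definition delnth j t := take j t ++ drop j.+1 t.

(* The permanent of the matrix (z - a_i - b_j). *)
Fixpoint perm_sum (z : A) s t : A :=
  if s is a :: s' then
    \sum_(j < size t) (z - a - t`_j) * perm_sum z s' (delnth j t)
  else 1.

Lemma prodX_cons a s : prodX (a :: s) = ('X - a%:P) * prodX s.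
Proof. exact: big_cons. Qed.

Lemma size_prodX s : size (prodX s) = (size s).+1.
Proof. exact: size_prod_XsubC. Qed.

Lemma monic_prodX s : prodX s \is monic.
Proof. exact: monic_prod_XsubC. Qed.

Lemma prodX_perm s t : perm_eq s t -> prodX s = prodX t.
Proof. exact: perm_big. Qed.

Lemma perm_delnth j t : (j < size t)%N -> perm_eq t (t`_j :: delnth j t).
Proof.
move=> jt; rewrite -{1}(cat_take_drop j t) (drop_nth 0 jt).
by rewrite perm_catC /= perm_cons perm_catC.
Qed.

Lemma size_delnth j t : (j < size t)%N -> size (delnth j t) = (size t).-1.
Proof. by move=> /perm_delnth/perm_size ->. Qed.

Lemma prodX_delnth j t : (j < size t)%N ->
  prodX t = ('X - (t`_j)%:P) * prodX (delnth j t).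
Proof. by move=> /perm_delnth/prodX_perm ->; rewrite prodX_cons. Qed.

Lemma deriv_prodX t : (prodX t)^`() = \sum_(j < size t) prodX (delnth j t).
Proof.
elim: t => [|b t IH]; first by rewrite /prodX big_nil derivC big_ord0.
rewrite prodX_cons derivM IH derivXsubC mul1r big_ord_recl /=.
rewrite [delnth 0 _]/delnth take0 drop1 /= mulr_sumr; congr (_ + _).
by apply: eq_bigr => j _; rewrite -prodX_cons.
Qed.

End RootProducts.

Section Conv.
Variables (F : fieldType) (A : comAlgType F).
Implicit Types (P Q : {poly A}) (s t : seq A).

Lemma natf_fact_neq0 m : [pchar F] =i pred0 -> m`!%:R != 0 :> F.
Proof. by move=> /pcharf0P ->; rewrite -lt0n fact_gt0. Qed.

(** This is the formula (1/n!) sum_j P^(n-j)(x) Q^(j)(0), since j! Q_j = Q^(j)(0); the signs of the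
    definition cancel. It makes bilinearity and the behaviour under derivation evident. *)
Lemma ffconvE n P Q : [pchar F] =i pred0 -> (size P <= n.+1)%N ->
  ffconv n P Q =
  \sum_(j < n.+1) ((j`!%:R / n`!%:R : F) *: Q`_j) *: P^`(n - j).
Proof.
move=> F0 sP; apply/polyP => m; rewrite /ffconv !coef_sum.
have [mn|nm] := leqP m n; last first.
  rewrite !big1 // => j _; rewrite coefZ.
    by rewrite coef_derivn [P`__]nth_default ?mul0rn ?mulr0 //; apply: leq_trans sP _; lia.
  by rewrite coefXn; case: eqP => [|_]; rewrite ?mulr0 //; have := ltn_ord j; lia.
have Km : (n - m < n.+1)%N by lia.
rewrite (bigD1 (Ordinal Km)) //= big1 => [|j /eqP jK]; last first.
  rewrite coefZ coefXn; case: eqP => [E|_]; rewrite ?mulr0 //.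
  by case: jK; apply: val_inj => /=; have := ltn_ord j; lia.
rewrite addr0 coefZ coefXn subKn // eqxx mulr1 /ffconv_coef mulr_sumr.
rewrite -(big_mkord xpredT (fun j => ((j`!%:R / n`!%:R *: Q`_j) *: P^`(n - j))`_m)) /=.
(* The terms with j < m vanish, because P^(n-j) has degree at most j. *)
rewrite (big_cat_nat (n := m)) //=; last by lia.
rewrite [X in X + _]big_nat_cond [X in X + _]big1 ?add0r; last first.
  move=> j; rewrite andbT => /andP[_ jm].
  by rewrite coefZ coef_derivn [P`__]nth_default ?mul0rn ?mulr0 //; apply: leq_trans sP _; lia.
rewrite -[X in _ = \sum_(X <= _ < _) _]add0n big_addn subSn // big_mkord; apply: eq_bigr => i _.
have iK : (i <= n - m)%N by rewrite -ltnS; exact: ltn_ord.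
rewrite coefZ coef_derivn /signed_coef /ffconv_weight.
have -> : (n - (n - m - i) = i + m)%N by lia.
have -> : (n - (i + (n - m - i)) = m)%N by lia.
have -> : (n - (i + m) + m = n - i)%N by lia.
have sg (x y : A) : (-1) ^+ (n - m) * ((-1) ^+ i * x * ((-1) ^+ (n - m - i) * y)) = x * y.
  rewrite -{1}(subnKC iK) exprD -{2}[x](signrMK i) -{2}[y](signrMK (n - m - i)).
  by ring.
rewrite -scalerAr sg -scalerAl -[_ *+ ((n - i) ^_ _)]mulr_natr.
have -> : ((n - i) ^_ (n - (i + m)))%:R = ((n - i)`!%:R / m`!%:R : F)%:A :> A.
  rewrite -(@ffact_fact (n - i) (n - (i + m))); last by lia.
  have -> : (n - i - (n - (i + m)) = m)%N by lia.
  by rewrite natrM mulfK ?scaler_nat // natf_fact_neq0.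
rewrite mulr_algr -scalerAr scalerA [P`__ * _]mulrC; congr (_ *: _).
by rewrite !natrM invfM; ring.
Qed.


Hypothesis F0 : [pchar F] =i pred0.

Lemma mulrn_scale (x : A) m : x *+ m = (m%:R : F) *: x.
Proof. by rewrite scaler_nat. Qed.

Lemma ffconvDr n P Q1 Q2 : (size P <= n.+1)%N ->
  ffconv n P (Q1 + Q2) = ffconv n P Q1 + ffconv n P Q2.
Proof.
move=> sP; rewrite !ffconvE // -big_split; apply: eq_bigr => j _.
by rewrite coefD scalerDr scalerDl.
Qed.

Lemma ffconvZr n P c Q : (size P <= n.+1)%N ->
  ffconv n P (c *: Q) = c *: ffconv n P Q.
Proof.
move=> sP; rewrite !ffconvE // scaler_sumr; apply: eq_bigr => j _.
by rewrite coefZ scalerA scalerAr.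
Qed.

Lemma ffconv_sumr n P I r (f : I -> {poly A}) : (size P <= n.+1)%N ->
  ffconv n P (\sum_(i <- r) f i) = \sum_(i <- r) ffconv n P (f i).
Proof.
move=> sP; elim/big_rec2: _ => [|i Q1 Q2 _ <-]; last by rewrite ffconvDr.
by rewrite -[X in ffconv _ _ X](scale0r 0) ffconvZr // scale0r.
Qed.

(** For P of degree at most n the term j = 0 contains P^(n+1) = 0; the other terms form a
    convolution in degree n with Q' / (n+1). *)
Lemma ffconv_deriv_r n P Q : (size P <= n.+1)%N ->
  ffconv n.+1 P Q = ffconv n P ((n.+1%:R^-1 : F)%:A *: Q^`()).
Proof.
move=> sP; rewrite !ffconvE //; last exact: leqW.
rewrite big_ord_recl subn0 derivn_poly0 // scaler0 add0r; apply: eq_bigr => j _.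
rewrite /= /bump /= add1n subSS coefZ coef_deriv; congr (_ *: _).
rewrite mulr_algl mulrn_scale 2!scalerA; congr (_ *: _).
have N0 : n.+1%:R != 0 :> F by move/pcharf0P: F0 => ->.
have M0 := natf_fact_neq0 n F0.
by rewrite !factS !natrM; field; rewrite nat1r N0.
Qed.

Lemma derivn_mulXsubC a P k :
  (('X - a%:P) * P)^`(k.+1) = ('X - a%:P) * P^`(k.+1) + P^`(k) *+ k.+1.
Proof.
elim: k => [|k IH]; first by rewrite derivn1 derivM derivXsubC mul1r addrC.
rewrite derivnS IH derivD derivM derivXsubC mul1r derivMn -!derivnS.
by rewrite [P^`(k.+1) + _]addrC -addrA -mulrS.
Qed.

(** By Leibniz' rule, removing the factor X - a replaces Q by its polar derivative with respect to z
    - a, divided by the degree n + 1. The pole depends on z, hence the identity is one between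
    values at z. *)
Lemma ffconv_mulXsubC n a P Q z : (size P <= n.+1)%N ->
  (ffconv n.+1 (('X - a%:P) * P) Q).[z] =
  (ffconv n P (Q + (n.+1%:R^-1 : F)%:A *: (((z - a)%:P - 'X) * Q^`()))).[z].
Proof.
move=> sP; set c := _%:A.
have N0 : n.+1%:R != 0 :> F by move/pcharf0P: F0 => ->.
(* The first summand brings back the convolution of P and Q in degree n + 1, by [ffconv_deriv_r];
   the second has coefficients (1 - j/(n+1)) Q_j and so lacks the term j = n + 1. *)
have -> : Q + c *: (((z - a)%:P - 'X) * Q^`()) =
    (z - a) *: (c *: Q^`()) + (Q - c *: ('X * Q^`())).
  by rewrite -!mul_polyC; ring.
rewrite ffconvDr // ffconvZr // -ffconv_deriv_r // hornerD hornerZ.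
have sXP : (size (('X - a%:P) * P)%R <= n.+2)%N.
  by apply: leq_trans (size_polyMleq _ _) _; rewrite size_XsubC.
rewrite -[z - a](hornerXsubC a z) -hornerM -hornerD; congr _.[z].
rewrite !ffconvE //; last exact: leqW.
rewrite [in LHS]big_ord_recr [X in _ = _ * X + _]big_ord_recr /= !subnn !derivn0.
rewrite mulrDr -scalerAr [in RHS]addrAC; congr (_ + _).
rewrite mulr_sumr -big_split; apply: eq_bigr => j _ /=.
have jn : (j <= n)%N by rewrite -ltnS.
rewrite subSn // derivn_mulXsubC scalerDr scalerAr; congr (_ + _).
rewrite -scalerMnr scalerMnl; congr (_ *: _).
rewrite coefD coefN coefZ coefXM coef_deriv /c mulr_algl !mulrn_scale.
case: j jn => [[|j] jlt] jn /=.
  rewrite scaler0 subr0 subn0 scalerA; congr (_ *: _).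
  by rewrite factS natrM; field; rewrite nat1r N0 natf_fact_neq0.
rewrite -{2}[Q`__]scale1r !scalerA -scalerBl scalerA; congr (_ *: _).
rewrite [in n.+1`!]factS !natrM -subSn // subSS natrB; last by lia.
by field; rewrite nat1r N0 natf_fact_neq0.
Qed.

(* The left-hand side is the polar derivative of prod (X - t_j) with respect to
   z, divided by the degree. *)
Lemma polar_prodX t z : (0 < size t)%N ->
  prodX t + ((size t)%:R^-1 : F)%:A *: ((z%:P - 'X) * (prodX t)^`()) =
  \sum_(j < size t) (((size t)%:R^-1 : F)%:A * (z - t`_j)) *: prodX (delnth j t).
Proof.
move=> t0; have N0 : (size t)%:R != 0 :> F by move/pcharf0P: F0 => ->; rewrite -lt0n.
rewrite deriv_prodX mulr_sumr.
have -> : \sum_(j < size t) (z%:P - 'X) * prodX (delnth j t) =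
    \sum_(j < size t) (z - t`_j) *: prodX (delnth j t) - prodX t *+ size t.
  have -> : prodX t *+ size t = \sum_(j < size t) prodX t.
    by rewrite sumr_const card_ord.
  rewrite -sumrB; apply: eq_bigr => j _.
  rewrite [in RHS](prodX_delnth (ltn_ord j)) -mul_polyC -mulrBl; congr (_ * _).
  by rewrite !polyCB; ring.
rewrite scalerBr -scalerMnr scalerMnl [_%:A *+ _]mulrn_scale scalerA divff // !scale1r.
by rewrite addrC subrK scaler_sumr; apply: eq_bigr => j _; rewrite scalerA.
Qed.

(** Each root taken from s expands the permanent along one row: [ffconv_mulXsubC] removes the root,
    and [polar_prodX] writes the polar derivative as a sum over the columns. *)
Lemma ffconv_prodX s t z : size s = size t ->
  (ffconv (size s) (prodX s) (prodX t)).[z] =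
  ((size s)`!%:R^-1 : F) *: perm_sum z s t.
Proof.
elim: s t => [|a s IH] t /= st.
  case: t st => // _; rewrite ffconvE ?size_prodX // big_ord1 /=.
  by rewrite /prodX !big_nil coefC eqxx divr1 !scale1r hornerC invr1 scale1r.
rewrite prodX_cons ffconv_mulXsubC ?size_prodX //.
set c := (_ : F)%:A.
rewrite /c st polar_prodX -?st // -/c.
rewrite ffconv_sumr ?size_prodX // horner_sum scaler_sumr; apply: eq_bigr => j _.
rewrite ffconvZr ?size_prodX // hornerZ IH; last by rewrite size_delnth // -st.
rewrite /c -scalerAr -mulrA mulr_algl scalerA factS natrM invfM mulrC -scalerA.
by rewrite mulrC.
Qed.

End Conv.

(** * Convolution over a field *)

Section FieldConv.
Variable K : numFieldType.
Implicit Types (p q : {poly K}) (s t : seq K).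

Definition conv n p q : {poly K} := @ffconv K K^o n p q.

Lemma convE n p q : (size p <= n.+1)%N ->
  conv n p q = \sum_(j < n.+1) (j`!%:R / n`!%:R * q`_j) *: p^`(n - j).
Proof. exact: (@ffconvE K K^o n p q (pchar_num K)). Qed.

Lemma convZr n p c q : (size p <= n.+1)%N -> conv n p (c *: q) = c *: conv n p q.
Proof. exact: (@ffconvZr K K^o (pchar_num K)). Qed.

Lemma convDl n p1 p2 q : (size p1 <= n.+1)%N -> (size p2 <= n.+1)%N ->
  conv n (p1 + p2) q = conv n p1 q + conv n p2 q.
Proof.
move=> s1 s2; rewrite !convE //; last first.
  by apply: leq_trans (size_polyD _ _) _; rewrite geq_max s1.
by rewrite -big_split; apply: eq_bigr => j _; rewrite derivnD scalerDr.
Qed.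

Lemma convZl n c p q : (size p <= n.+1)%N -> conv n (c *: p) q = c *: conv n p q.
Proof.
move=> sp; rewrite !convE //; last exact: leq_trans (size_scale_leq _ _) _.
by rewrite scaler_sumr; apply: eq_bigr => j _; rewrite derivnZ !scalerA mulrC.
Qed.

Lemma conv_suml n (I : finType) (f : I -> {poly K}) q :
  (forall i, (size (f i) <= n.+1)%N) ->
  conv n (\sum_i f i) q = \sum_i conv n (f i) q.
Proof.
move=> sf; rewrite convE; last first.
  by apply: leq_trans (size_sum _ _ _) _; apply/bigmax_leqP => i _.
under [RHS]eq_bigr do rewrite convE //.
rewrite exchange_big; apply: eq_bigr => j _ /=.
rewrite -scaler_sumr; congr (_ *: _); exact: (big_morph _ (derivnD _) (linear0 (derivn _))).
Qed.

Lemma conv_deriv n p q : (size p <= n.+1)%N -> (conv n p q)^`() = conv n p^`() q.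
Proof.
move=> sp; rewrite !convE //; last first.
  apply/leq_sizeP => i si; rewrite coef_deriv nth_default ?mul0rn //.
  exact: leq_trans sp (leqW si).
rewrite linear_sum /=; apply: eq_bigr => j _.
by rewrite derivZ -derivnS derivSn.
Qed.

Lemma conv_deriv_r n p q : (size p <= n.+1)%N ->
  conv n.+1 p q = conv n p (n.+1%:R^-1 *: q^`()).
Proof.
move=> sp; rewrite [LHS](@ffconv_deriv_r K K^o (pchar_num K)) //.
by congr (@ffconv K K^o _ _ (_ *: _)); exact: mulr1.
Qed.

Lemma conv_prodX_cons a s t z : size t = (size s).+1 ->
  (conv (size s).+1 (prodX (a :: s)) (prodX t)).[z] =
  (conv (size s) (prodX s)
    ((size t)%:R^-1 *: \sum_(j < size t) (z - a - t`_j) *: prodX (delnth j t))).[z].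
Proof.
move=> st; rewrite prodX_cons [LHS](@ffconv_mulXsubC K K^o (pchar_num K)) ?size_prodX //.
rewrite -st (@polar_prodX K K^o (pchar_num K)) ?st //; congr (conv _ _ _).[_].
rewrite scaler_sumr; apply: eq_bigr => j _; rewrite scalerA.
by congr (_ * _ *: _); exact: mulr1.
Qed.

Lemma conv_prodX s t z : size s = size t ->
  (conv (size s) (prodX s) (prodX t)).[z] = (size s)`!%:R^-1 * perm_sum z s t.
Proof. exact: (@ffconv_prodX K K^o (pchar_num K)). Qed.

(** The derivative of order n - j of (X - a)^n is (n!/j!) (X - a)^j, so the factorials cancel and
    q_j (X - a)^j remains. *)
Lemma conv_exp_XsubC n a q : (size q <= n.+1)%N ->
  conv n (prodX (nseq n a)) q = q \Po ('X - a%:P).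
Proof.
move=> sq; have pE : prodX (nseq n a) = ('X - a%:P) ^+ n.
  by rewrite /prodX big_nseq; elim: n {sq} => [|n IH] //=; rewrite exprS IH.
have dE k : (('X - a%:P) ^+ n)^`(k) = ('X - a%:P) ^+ (n - k) *+ n ^_ k.
  elim: k => [|k IH]; first by rewrite derivn0 subn0.
  rewrite derivnS IH derivMn deriv_exp derivXsubC mul1r -mulrnA subnS mulnC ffactnSr.
  by [].
rewrite convE ?size_prodX ?size_nseq // pE /comp_poly.
rewrite (@horner_coef_wide _ n.+1) ?size_map_polyC //; apply: eq_bigr => j _.
have jn : (j <= n)%N by rewrite -ltnS.
rewrite coef_map /= mul_polyC dE subKn // -scaler_nat [in LHS]scalerA [_ * _%:R]mulrC.
congr (_ *: _).
have n0 : n`!%:R != 0 :> K by rewrite pnatr_eq0 -lt0n fact_gt0.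
have := ffact_fact (leq_subr j n); rewrite subKn // => /(congr1 (fun k => k%:R : K)).
rewrite natrM => E; set A := (n ^_ _)%:R in E *; set B := j`!%:R in E *.
have -> : A * (B / n`!%:R * q`_j) = (A * B) / n`!%:R * q`_j by ring.
by rewrite E divff ?mul1r.
Qed.

(** In [convE] the term j = n is [prodX s] itself, and all others are multiples of its proper
    derivatives. *)
Lemma conv_monic s t : size s = size t ->
  conv (size s) (prodX s) (prodX t) \is monic /\
  size (conv (size s) (prodX s) (prodX t)) = (size s).+1.
Proof.
move=> st; rewrite convE ?size_prodX // big_ord_recr /= subnn derivn0.
have -> : (prodX t)`_(size s) = 1.
  have := monic_prodX t; rewrite monicE lead_coefE size_prodX => /eqP.
  by rewrite st.
rewrite mulr1 divff ?pnatr_eq0 -?lt0n ?fact_gt0 // scale1r addrC.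
set r := \sum_(_ < _) _.
have sr : (size r < size (prodX s))%N.
  rewrite size_prodX ltnS; apply: leq_trans (size_sum _ _ _) _.
  apply/bigmax_leqP => j _; apply: leq_trans (size_scale_leq _ _) _.
  apply/leq_sizeP => i si; rewrite coef_derivn nth_default ?mul0rn // size_prodX.
  by have := ltn_ord j; lia.
by rewrite monicE lead_coefDl // size_polyDl // size_prodX -monicE monic_prodX.
Qed.

End FieldConv.

Lemma map_conv (K L : numFieldType) (f : {rmorphism K -> L}) n (p q : {poly K}) :
  (size p <= n.+1)%N -> map_poly f (conv n p q) = conv n (map_poly f p) (map_poly f q).
Proof.
move=> sp; rewrite !convE ?size_map_poly // rmorph_sum; apply: eq_bigr => j _ /=.
by rewrite map_polyZ derivn_map coef_map rmorphM fmorph_div !rmorph_nat.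
Qed.

(** * Real-rootedness of the convolution *)

Section UpperHalfPlane.
Variable R : realType.
Local Notation C := R[i].
Local Notation Re := (@complex.Re R).
Local Notation Im := (@complex.Im R).
Implicit Types (s t : seq C) (z w b : C).

Local Notation lower t := (all (fun b => Im b <= 0) t).

Lemma Re_sum I (r : seq I) (f : I -> C) : Re (\sum_(i <- r) f i) = \sum_(i <- r) Re (f i).
Proof.
by apply: (big_morph Re) => // -[? ?] [].
Qed.

Lemma Im_sum I (r : seq I) (f : I -> C) : Im (\sum_(i <- r) f i) = \sum_(i <- r) Im (f i).
Proof.
by apply: (big_morph Im) => // -[? ?] [].
Qed.

(* The images of the b_j under b |-> c(b) / (w - b) lie in an open half-plane
   whose boundary passes through 0, so their sum does not vanish. *)
Lemma sum_delnth_neq0 k (c : C -> C) t w : (0 < size t)%N -> 0 < Im w -> lower t ->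
  {in t, forall b, 0 < Re (k * (c b / (w - b)))} ->
  (\sum_(j < size t) c t`_j *: prodX (delnth j t)).[w] != 0.
Proof.
move=> t0 w0 lt ck; have nz b : b \in t -> w - b != 0.
  move=> /(allP lt) b0; apply: contraTneq w0 => /subr0_eq ->.
  by rewrite -leNgt.
have tw : (prodX t).[w] != 0.
  rewrite -rootE root_prod_XsubC; apply: contraTN w0 => /(allP lt).
  by rewrite -leNgt.
rewrite horner_sum (eq_bigr (fun j : 'I_(size t) => (prodX t).[w] * (c t`_j / (w - t`_j)))).
  rewrite -mulr_sumr mulf_neq0 //; set S := \sum_(_ < _) _.
  suff : 0 < Re (k * S) by apply: contraTneq => ->; rewrite mulr0 ltxx.
  rewrite /S mulr_sumr Re_sum; move: t0 ck; case: (t) => [|b u] // _ ck.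
  rewrite big_ord_recl; apply: ltr_pwDl; first by apply: ck; exact: mem_nth.
  by apply: sumr_ge0 => j _; apply: ltW; apply: ck; apply: mem_nth; rewrite /= ltnS.
move=> j _; rewrite hornerZ (prodX_delnth (ltn_ord j)) hornerM hornerXsubC.
by field; exact/nz/mem_nth.
Qed.

(* As b ranges over the lower half-plane, (z - b) / (w - b) sweeps out a disk
   with centre (z - conj w) / (w - conj w) that does not contain 0; the first factor is
   a positive multiple of the conjugate of that centre. *)
Lemma Laguerre_half_plane z w b : 0 < Im z -> 0 < Im w -> Im b <= 0 ->
  0 < Re (Complex (Im z + Im w) (Re z - Re w) * ((z - b) / (w - b))).
Proof.
case: z w b => [p q] [x h] [u v] /= q0 h0 v0.
set D := (x - u) ^+ 2 + (h - v) ^+ 2.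
have D0 : 0 < D by rewrite ltr_wpDl ?sqr_ge0 // exprn_gt0 //; lra.
set N := (q + h) * (q - v) * (h - v) + q * (x - u) ^+ 2 - v * (p - x) ^+ 2 + h * (p - u) ^+ 2.
rewrite [ltRHS](_ : _ = N / D).
  rewrite divr_gt0 // /N; have : 0 < (q + h) * (q - v) * (h - v) by rewrite !mulr_gt0 //; lra.
  have := mulr_ge0 (ltW q0) (sqr_ge0 (x - u)).
  have := mulr_ge0 (ltW h0) (sqr_ge0 (p - u)).
  have : 0 <= - v * (p - x) ^+ 2 by rewrite mulr_ge0 ?sqr_ge0 ?oppr_ge0.
  lra.
have : D != 0 by rewrite gt_eqF.
rewrite /N /D => D1; field.
by [].
Qed.

Lemma lower_roots (p : {poly C}) : p != 0 -> (forall w, 0 < Im w -> p.[w] != 0) ->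
  exists2 t, p = lead_coef p *: prodX t & lower t.
Proof.
move=> p0 pw; have [t pt] := closed_field_poly_normal p; exists t => //.
apply/allP => b bt; rewrite leNgt; apply/negP => /pw; rewrite pt hornerZ.
by rewrite -[\prod_(_ <- _) _]/(prodX t) (rootP _) ?mulr0 ?eqxx // root_prod_XsubC.
Qed.

(* Grace's theorem for a half-plane; the induction step replaces prodX t by its
   polar derivative with respect to z - a (Laguerre). *)
Lemma conv_neq0_upper s t z : size s = size t -> lower s -> lower t -> 0 < Im z ->
  (conv (size s) (prodX s) (prodX t)).[z] != 0.
Proof.
elim: s t => [|a s IH] t /= st ls lt z0.
  by rewrite (conv_prodX (s := [::])) // fact0 invr1 mul1r /= oner_neq0.
have {ls} [a0 ls] := andP ls.
have za : 0 < Im (z - a) by case: (z) (a) z0 a0 => [? ?] [? ?] /=; lra.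
rewrite conv_prodX_cons // convZr ?size_prodX // hornerZ mulf_neq0 //.
  by rewrite invr_eq0 pnatr_eq0 -st.
set q := \sum_(_ < _) _.
(* Up to a constant, q is the polar derivative of [prodX t] with respect to z - a; by Laguerre it
   has no zero in the upper half-plane either. *)
have qw w : 0 < Im w -> q.[w] != 0.
  move=> w0; pose k := Complex (Im (z - a) + Im w) (Re (z - a) - Re w).
  apply: (@sum_delnth_neq0 k (fun b => z - a - b)) => //.
    by rewrite -st.
  by move=> b /(allP lt) b0; exact: Laguerre_half_plane.
have q0 : q != 0.
  by apply: contraNneq (qw 'i%C ltr01) => ->; rewrite horner0.
have [t1 qt lt1] := lower_roots q0 qw.
(* The degree does not drop further: the coefficient of X^(size s) in q is the sum of the z - a -
   t_j, which all have positive imaginary part. *)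
have qs : size q = size t.
  apply/eqP; rewrite eqn_leq; apply/andP; split.
    apply: leq_trans (size_sum _ _ _) _; apply/bigmax_leqP => j _.
    apply: leq_trans (size_scale_leq _ _) _.
    by rewrite size_prodX size_delnth // prednK // -st.
  rewrite -st; apply: contraT; rewrite -leqNgt => /leq_sizeP/(_ _ (leqnn _)).
  rewrite coef_sum => /(congr1 Im); rewrite Im_sum /=.
  suff /gt_eqF/eqP :
    0 < \sum_(j < size t) Im ((z - a - t`_j) *: prodX (delnth j t))`_(size s) by [].
  have E (j : 'I_(size t)) :
      Im ((z - a - t`_j) *: prodX (delnth j t))`_(size s) = Im (z - a) - Im t`_j.
    have := monic_prodX (delnth j t).
    rewrite monicE lead_coefE size_prodX size_delnth // coefZ.
    rewrite (_ : (size t).-1 = size s) -?st //= => /eqP ->.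
    by rewrite mulr1; case: (z - a) (t`_j) => [? ?] [].
  rewrite (eq_bigr _ (fun j _ => E j)); case: (t) st lt => // b u _ /allP lt.
  rewrite big_ord_recl; apply: ltr_pwDl.
    by have := lt _ (mem_head b u); lra.
  by apply: sumr_ge0 => j _; have := lt _ (@mem_nth _ 0 (b :: u) (lift ord0 j) (ltn_ord _)); lra.
rewrite qt convZr ?size_prodX // hornerZ mulf_neq0 ?lead_coef_eq0 //.
apply: IH => //; have := congr1 (fun p : {poly C} => size p) qt.
by rewrite qs size_scale ?lead_coef_eq0 // size_prodX -st => -[].
Qed.

(** Nonreal roots of a real polynomial come in conjugate pairs, so a root below the real axis would
    give one above it. *)
Lemma splits_upper (f : {poly R}) : f \is monic ->
  (forall w, 0 < Im w -> (map_poly (real_complex R) f).[w] != 0) ->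
  exists s : seq R, f = prodX s.
Proof.
move=> fm fw; have f0 : map_poly (real_complex R) f != 0.
  by rewrite map_poly_eq0 monic_neq0.
have [t ft lt] := lower_roots f0 fw; exists (map Re t).
apply: (@map_poly_inj _ _ (real_complex R)); rewrite ft lead_coef_map (monicP fm).
rewrite rmorph1 scale1r /prodX rmorph_prod big_map; apply: eq_big_seq => b bt.
rewrite rmorphB /= map_polyX map_polyC /=; congr (_ - _%:P).
have b0 : Im b <= 0 := allP lt b bt.
case: (ltrP (Im b) 0) => [b1|b1]; last first.
  by case: (b) b0 b1 => x y /= y0 y1; congr Complex; apply/le_anti/andP.
have : 0 < Im (b^*)%C by case: (b) b1 => x y /=; lra.
move=> /fw; have : root (map_poly (real_complex R) f) b.
  by rewrite ft rootZ ?lead_coef_eq0 // root_prod_XsubC.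
have E : map_poly (@conjc R) (map_poly (real_complex R) f) = map_poly (real_complex R) f.
  by rewrite -map_poly_comp; apply: eq_map_poly => x; exact: conjc_real.
by rewrite -{1}E complex_root_conj /root => ->.
Qed.

Lemma map_prodX (s : seq R) :
  map_poly (real_complex R) (prodX s) = prodX (map (real_complex R) s).
Proof.
rewrite /prodX big_map rmorph_prod; apply: eq_bigr => a _.
by rewrite rmorphB /= map_polyX map_polyC.
Qed.

(** Real roots belong to the closed lower half-plane, so [conv_neq0_upper] and [splits_upper]
    apply. *)
Lemma conv_splits (s t : seq R) : size s = size t ->
  exists2 r : seq R, conv (size s) (prodX s) (prodX t) = prodX r & size r = size s.
Proof.
move=> st; have [cm cs] := conv_monic st.
have lower_real (u : seq R) : lower (map (real_complex R) u).
  by apply/allP => _ /mapP[x _ ->] /=.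
have [|r cr] := splits_upper cm.
  move=> w w0; rewrite map_conv ?size_prodX // !map_prodX -(size_map (real_complex R) s).
  by apply: conv_neq0_upper; rewrite ?size_map.
by exists r => //; move: cs; rewrite cr size_prodX => -[].
Qed.

(** Gauss-Lucas for the upper half-plane: f'/f is the sum of the 1 / (w - b), and these lie in a
    common open half-plane. *)
Lemma deriv_prodX_splits (t : seq R) : (0 < size t)%N ->
  exists2 t1 : seq R, (prodX t)^`() = (size t)%:R *: prodX t1 & size t1 = (size t).-1.
Proof.
move=> t0; have N0 : (size t)%:R != 0 :> R by rewrite pnatr_eq0 -lt0n.
set q := (size t)%:R^-1 *: (prodX t)^`().
have qE : (prodX t)^`() = (size t)%:R *: q by rewrite scalerA divff ?scale1r.
have sq : size q = size t.
  apply/eqP; rewrite size_scale ?invr_eq0 // eqn_leq; apply/andP; split.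
    by rewrite -ltnS -[(size t).+1]size_prodX lt_size_deriv // monic_neq0 // monic_prodX.
  rewrite -(prednK t0) ltnNge; apply/negP => /leq_sizeP/(_ _ (leqnn _)).
  rewrite coef_deriv prednK //; have := monic_prodX t.
  by rewrite monicE lead_coefE size_prodX => /eqP ->; apply/eqP.
have qm : q \is monic.
  rewrite monicE lead_coefE sq coefZ coef_deriv prednK //; have := monic_prodX t.
  by rewrite monicE lead_coefE size_prodX => /eqP ->; rewrite mulVf.
have [|r qr] := splits_upper qm.
  move=> w w0; rewrite map_polyZ hornerZ mulf_neq0 ?fmorph_eq0 ?invr_eq0 //=.
  rewrite -deriv_map map_prodX deriv_prodX.
  rewrite (eq_bigr (fun j : 'I__ => 1 *: prodX (delnth j (map (real_complex R) t)))); last first.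
    by move=> j _; rewrite scale1r.
  (* Multiplication by i turns the negative imaginary part of 1 / (w - x) into a positive real
     part. *)
  apply: (@sum_delnth_neq0 'i%C (fun=> 1)); rewrite ?size_map //.
    by apply/allP => _ /mapP[x _ ->] /=.
  move=> _ /mapP[x _ ->]; case: w w0 => u v /= v0.
  have D0 : 0 < (u - x) ^+ 2 + v ^+ 2 by rewrite ltr_wpDl ?sqr_ge0 // exprn_gt0.
  have := divr_gt0 v0 D0; rewrite [X in _ -> 0 < X](_ : _ = v / ((u - x) ^+ 2 + v ^+ 2)) //.
  by field; rewrite gt_eqF.
by exists r; rewrite ?qE ?qr //; move: sq; rewrite qr size_prodX => <-.
Qed.

End UpperHalfPlane.

(** * Pencils of real-rooted polynomials *)

Section RealRoots.
Variable R : realType.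
Implicit Types (p q f g : {poly R}) (s t : seq R).

(** This is -(f'/f)' = sum (x - a)^-2, multiplied by f^2. *)
Lemma sqr_deriv_prodX s x : (prodX s).[x] != 0 ->
  (prodX s)^`().[x] ^+ 2 - (prodX s).[x] * (prodX s)^`()^`().[x] =
  (prodX s).[x] ^+ 2 * \sum_(a <- s) (x - a)^-2.
Proof.
elim: s => [|a s IH]; first by rewrite /prodX !big_nil !derivC !horner0 expr0n /= !mulr0 subrr.
rewrite prodX_cons !hornerM hornerXsubC mulf_eq0 negb_or => /andP[xa /IH E].
rewrite !derivM !derivXsubC !mul1r derivD derivM derivXsubC mul1r big_cons.
rewrite !(hornerM, hornerD, hornerN, hornerX, hornerC) mulrDr.
set P := (prodX s).[x] in E *; set P1 := _^`().[x] in E *; set P2 := _^`()^`().[x] in E *.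
set S := \sum_(_ <- _) _ in E *.
rewrite [RHS](_ : _ = P ^+ 2 + (x - a) ^+ 2 * (P ^+ 2 * S)); last by field.
by rewrite -E; ring.
Qed.

Lemma poly_nonroot f (h : nat -> R) : f != 0 -> injective h -> exists j, f.[h j] != 0.
Proof.
move=> f0 hinj; apply: contrapT => /forallNP H.
have := max_poly_roots f0 (rs := map h (iota 0 (size f))).
rewrite size_map size_iota ltnn map_inj_uniq // iota_uniq => H1.
have : false by apply: H1 => //; apply/allP => _ /mapP[j _ ->]; exact/negPn/negP/H.
by [].
Qed.

Lemma poly_neq0_nonroot f : f != 0 -> exists c, f.[c] != 0.
Proof.
move=> f0; have inj : injective (fun j => j%:R : R) by exact: mulrIn (oner_neq0 R).
by have [j] := poly_nonroot f0 inj; exists j%:R.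
Qed.

(* If f vanished to order at least 3 and g did not vanish at x, the sum of the
   (x - rho)^-2 over the roots rho of f + c g would not depend on c, although
   these roots approach x as c tends to 0. *)
Lemma pencil_double_root f g x :
  (forall c, exists s : seq R, f + c *: g = prodX s) ->
  f.[x] = 0 -> f^`().[x] = 0 -> g.[x] = 0.
Proof.
move=> fg f0 f1; apply/eqP/negPn/negP => g0.
have L c : c != 0 -> exists2 s : seq R, f + c *: g = prodX s &
    c ^+ 2 * (g^`().[x] ^+ 2 - g.[x] * g^`()^`().[x]) - c * g.[x] * f^`()^`().[x] =
    (c * g.[x]) ^+ 2 * \sum_(a <- s) (x - a)^-2.
  move=> c0; have [s E] := fg c; exists s => //.
  have hx : (prodX s).[x] = c * g.[x] by rewrite -E hornerD hornerZ f0 add0r.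
  rewrite -hx -sqr_deriv_prodX ?hx ?mulf_neq0 // -E !(derivD, derivZ, hornerD, hornerZ) f1.
  by ring.
set k := g^`().[x] ^+ 2 - _ in L; set d := f^`()^`().[x] in L.
have sum_ge0 s : 0 <= \sum_(a <- s) (x - a)^-2.
  by apply: sumr_ge0 => a _; rewrite invr_ge0 sqr_ge0.
(* If f has order exactly 2 at x, take c small and of the sign of g(x) f''(x): the left-hand side of
   [L] becomes negative, whereas the right-hand side is a nonnegative sum of squares. *)
have [d0|d0] := eqVneq d 0; last first.
  set e := g.[x] * d; have e0 : e != 0 by rewrite mulf_neq0.
  set c := e / (`|k| + 1); have k1 : 0 < `|k| + 1 by rewrite ltr_wpDl.
  have c0 : c != 0 by rewrite mulf_neq0 // invr_eq0 gt_eqF.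
  have [s _] := L c c0; rewrite -mulrA -/e => E.
  have : 0 <= c ^+ 2 * k - c * e by rewrite E mulr_ge0 ?sqr_ge0.
  have -> : c ^+ 2 * k - c * e = c ^+ 2 * (k - `|k| - 1).
    by rewrite /c; field; rewrite gt_eqF.
  have : 0 < c ^+ 2 by rewrite exprn_even_gt0.
  have := ler_norm k; nra.
have K c : c != 0 -> exists2 s : seq R, f + c *: g = prodX s &
    \sum_(a <- s) (x - a)^-2 = k / g.[x] ^+ 2.
  move=> c0; have [s E1 E2] := L c c0; exists s => //.
  have n0 : (c * g.[x]) ^+ 2 != 0 by rewrite expf_neq0 // mulf_neq0.
  by apply: (mulfI n0); rewrite -E2 d0; field.
set m := k / _ in K; have m0 : 0 <= m by have [s _ <-] := K 1 (oner_neq0 _); exact: sum_ge0.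
have fN0 : f != 0.
  have [s fs] := fg 0; move: fs; rewrite scale0r addr0 => ->.
  exact/monic_neq0/monic_prodX.
have gN0 : g != 0 by apply: contraNneq g0 => ->; rewrite horner0.
(* A point y so close to x that the single term (x - y)^-2 exceeds the constant value m of the
   sum. *)
have [y [xy ym fy gy]] : exists y, [/\ y != x, m * (x - y) ^+ 2 < 1, f.[y] != 0 & g.[y] != 0].
  have fgN0 : f * g != 0 by rewrite mulf_neq0.
  pose h j : R := x + (m + 1)^-1 / j.+1%:R.
  have m1 : m + 1 != 0 by rewrite gt_eqF // ltr_wpDl.
  have hinj : injective h.
    move=> i j /addrI/(mulfI _)/invr_inj/eqP; rewrite ?invr_eq0 // eqr_nat => ij.
    by have := ij m1 => /eqP[].
  have [j] := poly_nonroot fgN0 hinj; rewrite hornerM mulf_eq0 negb_or => /andP[fj gj].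
  exists (h j); split => //.
    by rewrite -subr_eq0 addrC addKr mulf_neq0 // invr_eq0 // pnatr_eq0.
  have -> : x - h j = - ((m + 1)^-1 / j.+1%:R) by rewrite /h; ring.
  have e0 : 0 < (m + 1)^-1 by rewrite invr_gt0 ltr_wpDl.
  have me : m * (m + 1)^-1 = 1 - (m + 1)^-1 by field.
  set e := (m + 1)^-1 in e0 me *.
  have ej : e / j.+1%:R <= e by rewrite ler_pdivrMr // ler_peMr ?ler1n // ltW.
  have ej0 : 0 < e / j.+1%:R by rewrite divr_gt0.
  apply: (@le_lt_trans _ _ (m * e ^+ 2)).
    by rewrite sqrrN ler_wpM2l // ler_pXn2r // nnegrE ltW.
  rewrite expr2 mulrA me; nra.
(* For this c the point y is a root of f + c g. *)
have c0 : - (f.[y] / g.[y]) != 0 by rewrite oppr_eq0 mulf_neq0 ?invr_eq0.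
have [s E1 E2] := K _ c0.
have : y \in s.
  rewrite -root_prod_XsubC -[\prod_(_ <- _) _]/(prodX s) -E1 /root.
  by rewrite hornerD hornerZ mulNr divfK // subrr.
move=> ys; move: ym; rewrite -E2 (big_rem y) //= mulrDl mulVf ?expf_neq0 ?subr_eq0 1?eq_sym //.
by rewrite ltNge lerDl mulr_ge0 ?sqr_ge0 // sum_ge0.
Qed.

Lemma mup_prodX s b : mup b (prodX s) = count_mem b s.
Proof.
elim: s => [|a s IH]; first by rewrite /prodX big_nil mupNroot // root1.
rewrite prodX_cons mupM ?polyXsubC_eq0 ?monic_neq0 ?monic_prodX // IH /=.
by rewrite -['X - _]expr1 mup_XsubCX; case: eqP.
Qed.

(** At a root of [prodX t] the multiplicity drops by one. Elsewhere a root of the derivative is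
    simple, because f'^2 - f f'' is positive there by [sqr_deriv_prodX]. *)
Lemma count_deriv_prodX t t1 b : (0 < size t)%N ->
  (prodX t)^`() = (size t)%:R *: prodX t1 ->
  (count_mem b t1 <= maxn (count_mem b t).-1 1)%N.
Proof.
move=> t0 tt1; have N0 : (size t)%:R != 0 :> R by rewrite pnatr_eq0 -lt0n.
have [bt|bt] := boolP (b \in t); last first.
  rewrite leq_max; apply/orP; right.
  rewrite leqNgt -mup_prodX mup_geq ?(monic_neq0 (monic_prodX t1)) //.
  apply/negP => /dvdpP[g t1g].
  have tb : (prodX t).[b] != 0 by rewrite -rootE root_prod_XsubC.
  have := sqr_deriv_prodX tb; rewrite tt1 t1g derivZ derivM expr2 derivM derivXsubC.
  rewrite !(hornerM, hornerD, hornerN, hornerZ, hornerX, hornerC) subrr.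
  rewrite !(mulr0, mul0r, addr0) subrr.
  move/esym/eqP; rewrite mulf_eq0 expf_eq0 (negPf tb) /=; apply/negP.
  rewrite gt_eqF //; case: (t) t0 bt => // a u _; rewrite inE negb_or => /andP[ba _].
  rewrite big_cons ltr_pwDl ?invr_gt0 ?exprn_even_gt0 ?subr_eq0 //.
  by apply: sumr_ge0 => c _; rewrite invr_ge0 sqr_ge0.
rewrite leq_max -(@mup_prodX t); apply/orP; left.
have [k [q]] := multiplicity_XsubC (prodX t) b; rewrite monic_neq0 ?monic_prodX //= => qb tq.
rewrite tq mupMr // mup_XsubCX eqxx.
move: tt1; rewrite tq.
case: k tq => [|k] tq.
  by move: bt qb; rewrite -root_prod_XsubC -[\prod_(_ <- _) _]/(prodX t) tq mulr1 => ->.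
move=> /(congr1 (mup b)); rewrite -mul_polyC mupMr ?rootC // mup_prodX => <-.
have -> : (q * ('X - b%:P) ^+ k.+1)^`() =
    (q^`() * ('X - b%:P) + q *+ k.+1) * ('X - b%:P) ^+ k.
  by rewrite derivM deriv_exp derivXsubC mul1r /= mulrDl exprS mulrA mulrnAl mulrnAr.
rewrite mupMr ?mup_XsubCX ?eqxx // /root hornerD !hornerM hornerXsubC subrr mulr0 add0r.
by rewrite hornerMn mulrn_eq0.
Qed.

End RealRoots.

(** * Multiple roots of a convolution *)

Section Multiplicity.
Variable R : realType.
Implicit Types (p q : {poly R}) (s t f u : seq R).

Lemma conv_prodX_deriv n s t t1 : (size s <= n)%N ->
  (prodX t)^`() = n.+1%:R *: prodX t1 ->
  conv n.+1 (prodX s) (prodX t) = conv n (prodX s) (prodX t1).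
Proof.
move=> sn tt1; rewrite conv_deriv_r ?size_prodX // tt1 scalerA mulVf ?scale1r //.
by rewrite pnatr_eq0.
Qed.

(** The convolution is affine in each root of the first factor, and its slope is, up to sign, the
    convolution with that root deleted. *)
Lemma conv_linear_factor n c f q : (size f < n)%N ->
  conv n (prodX (c :: f)) q = conv n ('X * prodX f) q - c *: conv n (prodX f) q.
Proof.
move=> fn; have f0 : prodX f != 0 by rewrite monic_neq0 ?monic_prodX.
have s0 : (size (prodX f) <= n.+1)%N by rewrite size_prodX ltnW.
have s1 : (size ('X * prodX f)%R <= n.+1)%N by rewrite mulrC size_mulX // size_prodX.
have s2 : (size (- c *: prodX f) <= n.+1)%N by exact: leq_trans (size_scale_leq _ _) s0.
by rewrite prodX_cons mulrBl mul_polyC -scaleNr convDl // convZl // scaleNr.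
Qed.

(** The dependence on two roots is through their sum and product only; this describes how a pair of
    roots can be moved. *)
Lemma conv_quadratic_factor n c d f q : ((size f).+1 < n)%N ->
  conv n (prodX (c :: d :: f)) q =
  conv n ('X * ('X * prodX f)) q - (c + d) *: conv n ('X * prodX f) q
  + (c * d) *: conv n (prodX f) q.
Proof.
move=> fn; have E : prodX (c :: d :: f) =
    'X * ('X * prodX f) + (- (c + d) *: ('X * prodX f) + (c * d) *: prodX f).
  by rewrite !prodX_cons -!mul_polyC !rmorphN !rmorphD !rmorphM /=; ring.
have f0 : prodX f != 0 by rewrite monic_neq0 ?monic_prodX.
have s0 : (size (prodX f) <= n.+1)%N by rewrite size_prodX leqW // ltnW.
have s1 : (size ('X * prodX f)%R <= n.+1)%N by rewrite mulrC size_mulX // size_prodX leqW.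
have s2 : (size ('X * ('X * prodX f))%R <= n.+1)%N.
  by rewrite mulrC size_mulX ?mulf_neq0 ?polyX_eq0 // mulrC size_mulX // size_prodX.
have sZ c1 (g : {poly R}) : (size g <= n.+1)%N -> (size (c1 *: g) <= n.+1)%N.
  by move=> sg; exact: leq_trans (size_scale_leq _ _) sg.
have s3 : (size ((- (c + d)) *: ('X * prodX f) + (c * d) *: prodX f)%R <= n.+1)%N.
  by rewrite (leq_trans (size_polyD _ _)) // geq_max !sZ.
by rewrite E convDl // convDl ?sZ // !convZl // scaleNr addrA.
Qed.

(* Deforming a root of the first factor does not destroy real-rootedness. *)
Lemma conv_double_root_delete n a s t x : (size s).+1 = n -> size t = n ->
  (conv n (prodX (a :: s)) (prodX t)).[x] = 0 ->
  (conv n (prodX (a :: s)) (prodX t))^`().[x] = 0 ->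
  (conv n (prodX s) (prodX t)).[x] = 0.
Proof.
(* Moving the root a to a - c adds c times the convolution with a deleted, and the result is
   real-rooted by [conv_splits]. *)
move=> sn tn r0 r1; apply: pencil_double_root r0 r1 => c.
have [|r rE _] := @conv_splits R (a - c :: s) t; first by rewrite /= sn.
by exists r; rewrite -rE /= sn !conv_linear_factor -?sn // scalerBl opprB addrA addrAC.
Qed.

Lemma linear_two_zeros (a d g0 g1 : R) : d != a ->
  g1 - a * g0 = 0 -> g1 - d * g0 = 0 -> g0 = 0 /\ g1 = 0.
Proof.
move=> da ga gd; have g00 : g0 = 0.
  have : (d - a) * g0 = 0 by lra.
  by move/eqP; rewrite mulf_eq0 subr_eq0 (negPf da) => /eqP.
by split=> //; move: ga; rewrite g00 mulr0 subr0.
Qed.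

Lemma bilinear_generic_zero (g0 g1 g2 a d : R) f :
  g1 - a * g0 != 0 -> g1 - d * g0 != 0 -> g2 - (a + d) * g1 + a * d * g0 = 0 ->
  exists c e, [/\ g2 - (c + e) * g1 + c * e * g0 = 0, c \notin e :: f & e \notin f].
Proof.
move=> ga gd gad.
pose H r : {poly R} := (g2 - r * g1)%:P + (r * g0 - g1) *: 'X.
(* If [H r] vanished, then g1 = r g0 and g2 = r^2 g0, and the form at (a, d) would be g0 (r - a) (r
   - d), which the hypotheses make nonzero. *)
have H0 r : H r != 0.
  apply/eqP => Hr; have := congr1 (fun p => p.[0]) Hr; have := congr1 (fun p => p.[1]) Hr.
  rewrite /H !hornerD !hornerZ !hornerX !hornerC mulr0 mulr1 addr0 => e1 e0.
  have e2 : g1 = r * g0 by lra.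
  have e3 : g2 = r * r * g0 by rewrite -mulrA -e2; lra.
  have E : (r - a) * g0 * (r - d) = 0 by rewrite -[RHS]gad e3 e2; ring.
  move: ga gd; rewrite e2 -!mulrBl !mulf_eq0 !negb_or => /andP[ra g00] /andP[rd _].
  by move/eqP: E; rewrite !mulf_eq0 (negPf ra) (negPf rd) (negPf g00).
pose D : {poly R} := g2%:P - (2 * g1) *: 'X + g0 *: 'X ^+ 2.
have D0 : D != 0.
  apply/eqP => Dr; have := congr1 (fun p => p.[0]) Dr.
  have := congr1 (fun p => p.[1]) Dr; have := congr1 (fun p => p.[-1]) Dr.
  rewrite /D !(hornerD, hornerN, hornerZ, hornerXn, hornerX, hornerC) => e1 e2 e3.
  have g00 : g0 = 0 by lra.
  have g10 : g1 = 0 by lra.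
  by move: ga; rewrite g00 g10 mulr0 subrr eqxx.
have L0 : g1%:P - g0 *: 'X != 0.
  apply: contraNneq ga => /(congr1 (fun p => p.[a])).
  by rewrite !(hornerD, hornerN, hornerZ, hornerX, hornerC, horner0) mulrC => ->.
have W0 : prodX f * (g1%:P - g0 *: 'X) * D * \prod_(r <- f) H r != 0.
  rewrite !mulf_neq0 ?(monic_neq0 (monic_prodX f)) //.
  by rewrite prodf_seq_neq0; apply/allP => r _; rewrite H0.
have [c] := poly_neq0_nonroot W0; rewrite !hornerM !mulf_eq0 !negb_or -!andbA => /and4P[cf Lc Dc].
rewrite horner_prod prodf_seq_neq0 => /allP Hc.
have {}cf : c \notin f by rewrite -root_prod_XsubC.
have {}Lc : g1 - c * g0 != 0.
  by move: Lc; rewrite !(hornerD, hornerN, hornerZ, hornerX, hornerC) mulrC.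
pose e := (g2 - c * g1) / (g1 - c * g0).
have E : g2 - (c + e) * g1 + c * e * g0 = 0 by rewrite /e; field.
exists c, e; split => //.
  rewrite inE negb_or cf andbT; apply: contraNneq Dc => ce.
  rewrite !(hornerD, hornerN, hornerZ, hornerXn, hornerX, hornerC) -[X in _ == X]E -ce.
  by apply/eqP; ring.
apply/negP => /Hc /=; apply/negP/negPn.
by rewrite /H hornerD hornerZ hornerX hornerC -[X in _ == X]E; apply/eqP; ring.
Qed.

(* Induction on n.  Suppose x is a double root.  By induction the convolutions
   with one root of s deleted have x as a simple root at most.  If s has two
   distinct roots a and d, this pair can be moved along the curve of pairs (c, e)
   for which x stays a double root; for generic c and e, deleting c and any other
   root gives a convolution that vanishes at x, so that deleting c alone gives a
   double root, a contradiction. *)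
Lemma conv_simple_roots n s t x : size s = n -> size t = n ->
  (forall a b, (count_mem a s + count_mem b t <= n.+1)%N) ->
  (conv n (prodX s) (prodX t)).[x] = 0 ->
  (conv n (prodX s) (prodX t))^`().[x] != 0.
Proof.
elim: n s t => [|n IH] s t ss st st_le r0.
  have := @conv_prodX R [::] [::] x erefl.
  move: r0; rewrite (size0nil ss) (size0nil st) => ->; rewrite fact0 invr1 mulr1.
  by move/esym/eqP; rewrite oner_eq0.
apply/negP => /eqP r1.
have t0 : (0 < size t)%N by rewrite st.
have [t1 tt1 st1] := deriv_prodX_splits t0.
have {}st1 : size t1 = n by rewrite st1 st.
have ct1 := fun b => count_deriv_prodX b t0 tt1.
rewrite st in tt1.
pose V p : {poly R} := conv n.+1 p (prodX t).
(* The induction hypothesis in degree n, with t replaced by the roots t1 of its derivative; [ct1]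
   carries over the bound on multiplicities. *)
have simple u : size u = n ->
    (forall a b, (count_mem a u + count_mem b t <= n.+2)%N) ->
    (V (prodX u)).[x] = 0 -> (V (prodX u))^`().[x] != 0.
  move=> su ut; rewrite /V (conv_prodX_deriv _ tt1) ?su // => v0.
  apply: IH => // a b; have := ct1 b; have := ut a b; have := count_size (pred1 a) u.
  by rewrite su; lia.
have delete a u : size u = n -> (V (prodX (a :: u))).[x] = 0 ->
    (V (prodX (a :: u)))^`().[x] = 0 -> (V (prodX u)).[x] = 0.
  by move=> su; apply: conv_double_root_delete => //; rewrite su.
case: s ss st_le r0 r1 => [//|a s] /= [ss] st_le r0 r1.
(* If all roots of the first factor equal a, the convolution is a translate of [prodX t]. A double
   root then comes from a double root of t, and the multiplicities add up to at least n + 3. *)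
have [/all_pred1P s_a|/allPn[d ds /= da]] := boolP (all (pred1 a) s).
  have sa : a :: s = nseq n.+1 a by rewrite s_a ss.
  move: r0 r1; rewrite sa conv_exp_XsubC ?size_prodX ?st //.
  rewrite deriv_comp derivXsubC mulr1 !horner_comp hornerXsubC => q0.
  have bt : x - a \in t by rewrite -root_prod_XsubC; apply/rootP.
  rewrite (prodX_perm (perm_to_rem bt)) prodX_cons derivM derivXsubC mul1r.
  rewrite hornerD hornerM hornerXsubC subrr mul0r addr0 => /rootP.
  rewrite root_prod_XsubC => bt1.
  have := st_le a (x - a); rewrite eqxx (permP (perm_to_rem bt)) /= eqxx.
  have -> : count_mem a s = n by rewrite s_a count_nseq /= eqxx mul1n ss.
  by move: bt1; rewrite -has_pred1 has_count; move: (count_mem _ _) => k /=; lia.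
pose f := rem d s.
have sf : perm_eq (a :: s) (d :: a :: f).
  by rewrite perm_sym (perm_catCA [:: d] [:: a] f) /= perm_cons perm_sym perm_to_rem.
have {}ss : (size f).+1 = n by rewrite size_rem // ss prednK // -ss; case: (s) ds.
have V1 c : V (prodX (c :: f)) = V ('X * prodX f) - c *: V (prodX f).
  by apply: conv_linear_factor; rewrite -ss.
have V2 c e : V (prodX (c :: e :: f)) = V ('X * ('X * prodX f))
    - (c + e) *: V ('X * prodX f) + (c * e) *: V (prodX f).
  by apply: conv_quadratic_factor; rewrite -ss.
rewrite -/(V _) in r0 r1.
have fd : V (prodX (a :: s)) = V (prodX (d :: a :: f)) by rewrite (prodX_perm sf).
have fa : V (prodX (a :: s)) = V (prodX (a :: d :: f)).
  by rewrite fd; congr V; apply/prodX_perm/permPl; exact: (perm_catCA [:: d] [:: a] f).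
have za : (V (prodX (a :: f))).[x] = 0.
  apply: (delete d (a :: f)); [exact: ss | rewrite -fd; exact: r0 | rewrite -fd; exact: r1].
have zd : (V (prodX (d :: f))).[x] = 0.
  apply: (delete a (d :: f)); [exact: ss | rewrite -fa; exact: r0 | rewrite -fa; exact: r1].
have cf b y : (count_mem y (b :: f) <= count_mem y (a :: s))%N -> forall e,
    (count_mem y (b :: f) + count_mem e t <= n.+2)%N.
  by move=> le e; apply: leq_trans (st_le y e); rewrite leq_add2r.
have na : (V (prodX (a :: f)))^`().[x] != 0.
  apply: (simple (a :: f) ss _ za) => y b; apply: cf; rewrite (permP sf) /=; lia.
have nd : (V (prodX (d :: f)))^`().[x] != 0.
  apply: (simple (d :: f) ss _ zd) => y b; apply: cf; rewrite (permP sf) /=; lia.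
set v0 := V (prodX f) in V1 V2; set v1 := V ('X * _) in V1 V2; set v2 := V ('X * _) in V2.
clearbody v0 v1 v2.
(* Deleting d or a leaves a zero at x, so an affine function has the two zeros a and d. Hence x is a
   root for every pair (c, e), and only the derivative imposes a condition on the pair. *)
have [x0 x1] : v0.[x] = 0 /\ v1.[x] = 0.
  by move: za zd; rewrite !V1 !(hornerD, hornerN, hornerZ); exact: linear_two_zeros.
have x2 : v2.[x] = 0.
  by move: r0; rewrite fd V2 !(hornerD, hornerN, hornerZ) x0 x1 !mulr0 subr0 addr0.
have [c [e [ce cef ef]]] : exists c e, [/\
    v2^`().[x] - (c + e) * v1^`().[x] + c * e * v0^`().[x] = 0, c \notin e :: f & e \notin f].
  apply: (@bilinear_generic_zero _ _ _ a d).
  - by move: na; rewrite V1 !(derivD, derivN, derivZ, hornerD, hornerN, hornerZ).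
  - by move: nd; rewrite V1 !(derivD, derivN, derivZ, hornerD, hornerN, hornerZ).
  - by rewrite -r1 fa V2 !(derivD, derivN, derivZ, hornerD, hornerN, hornerZ).
have w0 : (V (prodX (c :: e :: f))).[x] = 0.
  by rewrite V2 !(hornerD, hornerN, hornerZ) x0 x1 x2 !mulr0 subr0 addr0.
have w1 : (V (prodX (c :: e :: f)))^`().[x] = 0.
  by rewrite V2 !(derivD, derivN, derivZ, hornerD, hornerN, hornerZ).
set u := e :: f in cef w0 w1.
have su : size u = n by rewrite /= ss.
have u0 : (V (prodX u)).[x] = 0 by apply: (@delete c).
(* In u the root e occurs once and no other multiplicity exceeds that in the original list, so
   [simple] contradicts a double root. *)
suff : (V (prodX u))^`().[x] = 0.
  apply/eqP; apply: (simple u su _ u0) => y b; rewrite /u /=.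
  have [<-|_] := eqVneq e y.
    by rewrite (count_memPn ef) addn0 add1n ltnS -st count_size.
  have le : (count_mem y f <= count_mem y (a :: s))%N by rewrite (permP sf) /=; lia.
  by apply: leq_trans (st_le y b); rewrite add0n leq_add2r.
rewrite [(V _)^`()]conv_deriv; last by rewrite size_prodX su.
rewrite (deriv_prodX u).
(* As a function of b, the value at x for the roots b :: [delnth j u] is affine and vanishes at b =
   u_j and at b = c, which differ since c is not in u; hence its slope vanishes. *)
have zu (j : 'I_(size u)) : (V (prodX (delnth j u))).[x] = 0.
  have ju : perm_eq u (u`_j :: delnth j u) := perm_delnth (ltn_ord j).
  have sj : (size (delnth j u)).+1 = n by rewrite size_delnth // su prednK // -ss.
  have W1 b : V (prodX (b :: delnth j u)) =
      V ('X * prodX (delnth j u)) - b *: V (prodX (delnth j u)).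
    by apply: conv_linear_factor; rewrite -sj.
  have zc : (V (prodX (c :: delnth j u))).[x] = 0.
    have E : V (prodX (c :: u)) = V (prodX (u`_j :: c :: delnth j u)).
      congr V; apply: prodX_perm; rewrite perm_sym.
      by rewrite (perm_catCA [:: u`_j] [:: c] (delnth j u)) /= perm_cons perm_sym.
    apply: (delete u`_j (c :: delnth j u)); first exact: sj.
      by rewrite -E; exact: w0.
    by rewrite -E; exact: w1.
  have := u0; rewrite (prodX_perm ju); move: zc.
  rewrite !W1 !(hornerD, hornerN, hornerZ) => zc zj.
  have cu : u`_j != c by apply: contraNneq cef => <-; exact: mem_nth.
  exact: (linear_two_zeros cu zc zj).1.
have sz (j : 'I_(size u)) : (size (prodX (delnth j u)) <= n.+2)%N.
  by rewrite size_prodX size_delnth // su ltnS leqW // leq_pred.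
rewrite (conv_suml (prodX t) sz) horner_sum; apply: big1 => j _; exact: zu.
Qed.

(** Induction on the multiplicity m + 2, starting from [conv_simple_roots]. Two derivatives are
    involved: up to a constant, the derivative of the convolution is the convolution of the two
    derivatives in the next lower degree. *)
Lemma conv_multiple_root m n s t x : size s = n -> size t = n ->
  (forall k, (k < m.+2)%N -> (conv n (prodX s) (prodX t))^`(k).[x] = 0) ->
  exists a b, (n + m.+2 <= count_mem a s + count_mem b t)%N.
Proof.
elim: m n s t => [|m IH] n s t ss st r0.
  apply: contrapT => H.
  have := @conv_simple_roots n s t x ss st; rewrite -derivn1 !r0 // eqxx => simple.
  suff : false by [].
  apply: simple; last exact: (r0 0).
  move=> a b; rewrite leqNgt; apply/negP => ab; apply: H; exists a, b.
  by rewrite addn2.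
case: n ss st r0 => [|n] ss st r0.
  have := r0 0 isT; rewrite (size0nil ss) (size0nil st) derivn0 => /eqP.
  by rewrite (@conv_prodX R [::] [::]) // fact0 invr1 mulr1 oner_eq0.
have s0 : (0 < size s)%N by rewrite ss.
have t0 : (0 < size t)%N by rewrite st.
have [s1 ss1 sn] := deriv_prodX_splits s0; have [t1 tt1 tn] := deriv_prodX_splits t0.
have {}sn : size s1 = n by rewrite sn ss.
have {}tn : size t1 = n by rewrite tn st.
have cE : (conv n.+1 (prodX s) (prodX t))^`() = n.+1%:R *: conv n (prodX s1) (prodX t1).
  rewrite conv_deriv ?size_prodX ?ss // ss1 ss convZl ?size_prodX ?sn //.
  by rewrite (@conv_prodX_deriv n s1 t t1) ?sn // tt1 st.
have [k km|a [b ab]] := IH n s1 t1 sn tn.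
  have := r0 k.+1 km; rewrite derivSn cE derivnZ hornerZ => /eqP.
  by rewrite mulf_eq0 pnatr_eq0 => /eqP.
(* If one count for the derivatives were at most 1, the other would exceed n. So both are at least
   2, and each grows by at least one on return to s and t. *)
exists a, b; have := count_deriv_prodX a s0 ss1; have := count_deriv_prodX b t0 tt1.
have := count_size (pred1 a) s1; have := count_size (pred1 b) t1.
by rewrite sn tn; lia.
Qed.

End Multiplicity.

(** * The form h *)

Section PermSum.

Lemma map_delnth (A B : comNzRingType) (f : A -> B) j t :
  map f (delnth j t) = delnth j (map f t).
Proof. by rewrite /delnth map_cat map_take map_drop. Qed.

Lemma rmorph_perm_sum (A B : comNzRingType) (f : {rmorphism A -> B}) z s t :
  f (perm_sum z s t) = perm_sum (f z) (map f s) (map f t).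
Proof.
elim: s t => [|a s IH] t /=; first exact: rmorph1.
rewrite rmorph_sum size_map; apply: eq_bigr => j _.
by rewrite rmorphM !rmorphB /= IH map_delnth (nth_map 0).
Qed.

Lemma perm_sum_shift (A : comNzRingType) (z m k : A) s t :
  perm_sum z (map (+%R m) s) (map (+%R k) t) = perm_sum (z - m - k) s t.
Proof.
elim: s t => [|a s IH] t //=.
rewrite size_map; apply: eq_bigr => j _; rewrite -map_delnth IH (nth_map 0) //.
by congr (_ * _); ring.
Qed.

Variables (R : realType) (A : comAlgType R).
Implicit Types (f : {poly R}) (x S : A) (s t : seq R).

(** This is S^n f(x / S) for f of degree at most n, written without division. *)
Definition homogenize n f x S : A := \sum_(j < n.+1) f`_j *: (x ^+ j * S ^+ (n - j)).

Lemma homogenizeZ n c f x S : homogenize n (c *: f) x S = c *: homogenize n f x S.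
Proof.
by rewrite /homogenize scaler_sumr; apply: eq_bigr => j _; rewrite coefZ scalerA.
Qed.

Lemma homogenizeD n f g x S :
  homogenize n (f + g) x S = homogenize n f x S + homogenize n g x S.
Proof. by rewrite -big_split; apply: eq_bigr => j _; rewrite coefD scalerDl. Qed.

Lemma homogenize_sum n (I : finType) (f : I -> {poly R}) x S :
  homogenize n (\sum_i f i) x S = \sum_i homogenize n (f i) x S.
Proof.
rewrite exchange_big; apply: eq_bigr => j _.
by rewrite coef_sum scaler_suml.
Qed.

Lemma homogenize_mulXsubC n c f x S : (size f <= n.+1)%N ->
  homogenize n.+1 (('X - c%:P) * f) x S = (x - c *: S) * homogenize n f x S.
Proof.
move=> sf; have -> : ('X - c%:P) * f = (- c) *: f + 'X * f.
  by rewrite mulrBl mul_polyC scaleNr addrC.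
rewrite homogenizeD homogenizeZ mulrBl addrC; congr (_ + _).
  rewrite {1}/homogenize big_ord_recl coefXM eqxx scale0r add0r mulr_sumr.
  apply: eq_bigr => j _; rewrite coefXM /= /bump /= add1n subSS exprS -mulrA.
  by rewrite scalerAr.
rewrite /homogenize big_ord_recr /= (nth_default 0 sf) scale0r addr0.
rewrite scaleNr -scalerAl; congr (- (_ *: _)).
rewrite mulr_sumr; apply: eq_bigr => j _; rewrite subSn; last by rewrite -ltnS.
by rewrite exprS -scalerAr; congr (_ *: _); ring.
Qed.

Lemma homogenize_prodX r x S :
  homogenize (size r) (prodX r) x S = \prod_(a <- r) (x - a *: S).
Proof.
elim: r => [|a r IH].
  by rewrite /homogenize /prodX !big_nil big_ord1 coefC eqxx scale1r mulr1.
by rewrite prodX_cons big_cons homogenize_mulXsubC ?size_prodX // IH.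
Qed.

Lemma size_perm_sum_polyX s t :
  (size (perm_sum 'X (map polyC s) (map polyC t)) <= (size s).+1)%N.
Proof.
elim: s t => [|a s IH] t /=; first by rewrite size_polyC leq_b1.
apply: leq_trans (size_sum _ _ _) _; apply/bigmax_leqP => j _.
rewrite -map_delnth; have jt : (j < size t)%N by rewrite -(size_map polyC t).
rewrite (nth_map 0) // -addrA -opprD -polyCD.
by apply: leq_trans (size_polyMleq _ _) _; rewrite size_XsubC /= ltnS.
Qed.

(** Each entry x - (a + b) S of the matrix is the homogenization of X - (a + b), and
    [homogenize_mulXsubC] makes this multiplicative. *)
Lemma perm_sum_homogenize s t x S :
  perm_sum x (map ( *:%R^~ S) s) (map ( *:%R^~ S) t) =
  homogenize (size s) (perm_sum 'X (map polyC s) (map polyC t)) x S.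
Proof.
elim: s t => [|a s IH] t /=.
  by rewrite /homogenize big_ord1 coefC eqxx scale1r mulr1.
rewrite homogenize_sum !size_map; apply: eq_bigr => j _.
rewrite -!map_delnth !(nth_map 0) // IH -!addrA -!opprD -polyCD -scalerDl.
by rewrite homogenize_mulXsubC // size_perm_sum_polyX.
Qed.

End PermSum.

Section Bridge.
Variable R : realType.

Lemma poly_ext (p q : {poly R}) : (forall x, p.[x] = q.[x]) -> p = q.
Proof.
move=> pq; apply/eqP; rewrite -subr_eq0; apply: contraT => pq0.
have [c] := poly_neq0_nonroot pq0.
by rewrite hornerD hornerN pq subrr eqxx.
Qed.

Lemma perm_sum_polyX (s t : seq R) : size s = size t ->
  (size s)`!%:R^-1 *: perm_sum 'X (map polyC s) (map polyC t) =
  conv (size s) (prodX s) (prodX t).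
Proof.
move=> st; apply: poly_ext => z; rewrite conv_prodX // hornerZ; congr (_ * _).
have := rmorph_perm_sum (horner_eval z) 'X (map polyC s) (map polyC t).
have evC u : map (horner_eval z) (map polyC u) = u.
  by rewrite -map_comp -[RHS]map_id; apply: eq_map => a; rewrite /= horner_evalE hornerC.
by rewrite !evC => E; apply: etrans E _; congr perm_sum; exact: hornerX.
Qed.

Definition rowseq (B : Type) n (z : 'rV[B]_n) : seq B := [seq z 0 i | i <- enum 'I_n].

Lemma size_rowseq (B : Type) n (z : 'rV[B]_n) : size (rowseq z) = n.
Proof. by rewrite size_map size_enum_ord. Qed.

Lemma hform_perm_sum n (alpha beta u v : 'rV[R]_n) :
  hform alpha beta u v = (n`!%:R^-1 : R) *:
    perm_sum (varx R) (rowseq (pencil alpha u)) (rowseq (pencil beta v)).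
Proof.
rewrite /hform /ffconv_roots.
have root_polyE (z : 'rV[{mpoly R[3]}]_n) : root_poly z = prodX (rowseq z).
  by rewrite /root_poly /prodX /rowseq big_map big_enum.
have := @ffconv_prodX R {mpoly R[3]} (pchar_num R) (rowseq (pencil alpha u))
  (rowseq (pencil beta v)) (varx R).
by rewrite !size_rowseq !root_polyE => ->.
Qed.

Definition coords (x y t : R) (i : 'I_3) : R := [:: x; y; t]`_i.

Lemma hform_eval n (alpha beta u v : 'rV[R]_n) x y t :
  (hform alpha beta u v).@[coords x y t] =
  (conv n (prodX (rowseq (y *: alpha + t *: u))) (prodX (rowseq (y *: beta + t *: v)))).[x].
Proof.
have pencilE (a b : 'rV[R]_n) :
    map (meval (coords x y t)) (rowseq (pencil a b)) = rowseq (y *: a + t *: b).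
  rewrite /rowseq -map_comp; apply: eq_map => i /=.
  by rewrite !mxE mevalD !mevalZ !mevalXU mulrC [b _ _ * _]mulrC.
rewrite hform_perm_sum mevalZ (rmorph_perm_sum (meval (coords x y t))) !pencilE.
have := @conv_prodX R (rowseq (y *: alpha + t *: u)) (rowseq (y *: beta + t *: v)) x.
rewrite !size_rowseq => -> //; congr (_ * perm_sum _ _ _); exact: mevalXU.
Qed.

Lemma homog1_eval (p : {mpoly R[3]}) : p \is 1.-homog ->
  exists l m k : R, forall x y t, p.@[coords x y t] = l * x + m * y + k * t.
Proof.
move=> /dhomogP ph; pose c i := \sum_(m <- msupp p) p@_m * (m i)%:R.
exists (c ord0), (c (lift ord0 ord0)), (c (lift ord0 (lift ord0 ord0))) => x y t.
have -> : p.@[coords x y t] = \sum_i c i * coords x y t i.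
  rewrite mevalE; under [RHS]eq_bigr do rewrite mulr_suml.
  rewrite exchange_big; apply: eq_big_seq => m /ph /eqP /mdeg1P[i /eqP mi] /=.
  rewrite (bigD1 i) //= [in RHS](bigD1 i) //= !big1 ?addr0 ?mulr1.
  - by rewrite mi mnm1E eqxx expr1 mulr1.
  - by move=> j /negPf ji; rewrite mi mnm1E eq_sym ji mulr0 mul0r.
  - by move=> j /negPf ji; rewrite mi mnm1E eq_sym ji expr0.
by rewrite !big_ord_recl big_ord0 addr0 addrA.
Qed.

Lemma horner_derivn_mulXsubC_exp (k m : nat) (x : R) (g : {poly R}) : (k < m)%N ->
  ((('X - x%:P) ^+ m * g)^`(k)).[x] = 0.
Proof.
elim: k m g => [|k IH] [//|m] g km.
  by rewrite derivn0 exprS -mulrA hornerM hornerXsubC subrr mul0r.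
rewrite derivSn.
have -> : (('X - x%:P) ^+ m.+1 * g)^`() = ('X - x%:P) ^+ m * (g *+ m.+1 + ('X - x%:P) * g^`()).
  by rewrite derivM deriv_exp derivXsubC mul1r /= mulrDr mulrA -exprSr mulrnAl mulrnAr.
exact: IH.
Qed.

End Bridge.

(** * Splitting *)

Section Main.
Variable R : realType.

(** Each factor has a nonzero coefficient at x and can be normalized to x - g_i y - d_i t. *)
Lemma splits_linear_roots n (alpha beta u v : 'rV[R]_n) :
  splits_linear n (hform alpha beta u v) ->
  exists g d : 'rV[R]_n, forall y t,
    conv n (prodX (rowseq (y *: alpha + t *: u))) (prodX (rowseq (y *: beta + t *: v))) =
    prodX (rowseq (y *: g + t *: d)).
Proof.
move=> [L [Lh hL]].
have /choice[l lE] (i : 'I_n) : exists c : R * R * R, forall x y t,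
    (L i).@[coords x y t] = c.1.1 * x + c.1.2 * y + c.2 * t.
  by have [a [b [c E]]] := homog1_eval (Lh i); exists (a, b, c).
have E x y t : (conv n (prodX (rowseq (y *: alpha + t *: u)))
      (prodX (rowseq (y *: beta + t *: v)))).[x] =
    \prod_(i < n) ((l i).1.1 * x + (l i).1.2 * y + (l i).2 * t).
  by rewrite -hform_eval hL rmorph_prod; apply: eq_bigr => i _; exact: lE.
(* At y = t = 0 both arguments of the convolution are X^n, so h(1, 0, 0) = 1. *)
have l1 : \prod_(i < n) (l i).1.1 = 1.
  have := E 1 0 0; rewrite !scale0r addr0.
  have -> : rowseq (0 : 'rV[R]_n) = nseq n 0.
    have := size_rowseq (0 : 'rV[R]_n); set w := rowseq _ => <-.
    by apply/all_pred1P/allP => _ /mapP[i _ ->]; rewrite mxE /=.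
  rewrite conv_exp_XsubC ?size_prodX ?size_nseq // horner_comp hornerXsubC subr0.
  rewrite /prodX horner_prod big1_seq => [E1|a /andP[_ /nseqP[-> _]]].
    by rewrite [RHS]E1; apply: eq_bigr => i _; rewrite mulr1 !mulr0 !addr0.
  by rewrite hornerXsubC subr0.
have l0 i : (l i).1.1 != 0.
  have : \prod_(i < n) (l i).1.1 != 0 by rewrite l1 oner_neq0.
  by move/prodf_neq0/(_ i isT).
exists (\row_i (- ((l i).1.2 / (l i).1.1))), (\row_i (- ((l i).2 / (l i).1.1))) => y t.
apply: poly_ext => x; rewrite E -[RHS]mul1r -[X in _ = X * _]l1.
rewrite /prodX big_map big_enum horner_prod -big_split.
by apply: eq_bigr => i _; rewrite hornerXsubC !mxE /=; field; exact: l0.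
Qed.

Lemma count_rowseq n (z : 'rV[R]_n) a : count_mem a (rowseq z) = #|[set i | z 0 i == a]|.
Proof.
by rewrite -sum1_count big_map big_enum_cond sum1dep_card.
Qed.

Lemma count_rowseq_le1 n (z : 'rV[R]_n) a : injective (fun i => z 0 i) ->
  (count_mem a (rowseq z) <= 1)%N.
Proof. by move=> zi; rewrite count_uniq_mem ?leq_b1 // map_inj_uniq ?enum_uniq. Qed.

(** Two indices common to both clusters would have equal coordinates of y z + w at two values of y,
    hence equal coordinates of z. The bound follows by inclusion-exclusion. *)
Lemma count_pencil n (z w : 'rV[R]_n) (y y1 a a1 : R) : injective (fun i => z 0 i) ->
  y != y1 ->
  (count_mem a (rowseq (y *: z + w)) + count_mem a1 (rowseq (y1 *: z + w)) <= n.+1)%N.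
Proof.
move=> zi yy1; rewrite !count_rowseq -cardsUI -[n.+1]addn1 leq_add //.
  by apply: leq_trans (max_card _) _; rewrite card_ord.
apply/card_le1_eqP => i j; rewrite !inE !mxE => /andP[/eqP ia /eqP ia1] /andP[/eqP ja /eqP ja1].
have : (y - y1) * (z 0 i - z 0 j) = 0 by lra.
by move/eqP; rewrite mulf_eq0 !subr_eq0 (negPf yy1) => /eqP/zi.
Qed.

Lemma count_rowseq_full n (z : 'rV[R]_n) a : (n <= count_mem a (rowseq z))%N -> z = const_mx a.
Proof.
move=> na; apply/rowP => i; rewrite mxE.
have : [set i | z 0 i == a] = setT.
  by apply/eqP; rewrite eqEcard subsetT cardsT card_ord -count_rowseq.
by move/setP/(_ i); rewrite !inE => /eqP.
Qed.

Lemma prodX_rowseq n (z : 'rV[R]_n) : prodX (rowseq z) = \prod_(i < n) ('X - (z 0 i)%:P).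
Proof. by rewrite /prodX big_map big_enum. Qed.

Lemma conv_collision n (z e g : 'rV[R]_n) (i j : 'I_n) : i != j -> g 0 i = g 0 j ->
  conv n (prodX (rowseq z)) (prodX (rowseq e)) = prodX (rowseq g) ->
  exists a b, (n.+2 <= count_mem a (rowseq z) + count_mem b (rowseq e))%N.
Proof.
move=> ij gij cE.
have [k k2|a [b ab]] :=
  @conv_multiple_root R 0 n _ _ (g 0 i) (size_rowseq z) (size_rowseq e).
  rewrite cE prodX_rowseq (bigD1 i) //= (bigD1 j) 1?eq_sym //= -gij mulrA -expr2.
  exact: horner_derivn_mulXsubC_exp.
by exists a, b; rewrite -addn2.
Qed.

Lemma conv_full_collision n (z e g : 'rV[R]_n) (i0 : 'I_n) : (2 <= n)%N ->
  (forall i, g 0 i = g 0 i0) ->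
  conv n (prodX (rowseq z)) (prodX (rowseq e)) = prodX (rowseq g) ->
  exists a b, z = const_mx a /\ e = const_mx b.
Proof.
case: n z e g i0 => [|[|m]] // z e g i0 _ gi cE.
(* Here n = m + 2, so the two multiplicities add up to at least 2 n and both equal n. *)
have [k km|a [b ab]] :=
  @conv_multiple_root R m m.+2 _ _ (g 0 i0) (size_rowseq z) (size_rowseq e).
  rewrite cE prodX_rowseq; under eq_bigr do rewrite gi.
  rewrite prodr_const card_ord -[_ ^+ _]mulr1.
  exact: horner_derivn_mulXsubC_exp.
exists a, b; have := count_size (pred1 a) (rowseq z); have := count_size (pred1 b) (rowseq e).
rewrite !size_rowseq => be az.
by split; apply: count_rowseq_full; lia.
Qed.

Lemma splits_linear_form n (alpha beta u v : 'rV[R]_n) : (2 <= n)%N ->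
  injective (fun i : 'I_n => alpha 0 i) -> injective (fun i : 'I_n => beta 0 i) ->
  splits_linear n (hform alpha beta u v) ->
  exists a b c : R,
    u = a *: ones + c *: centered alpha /\ v = b *: ones + c *: centered beta.
Proof.
move=> n2 ha hb /splits_linear_roots[g [d gd]].
pose i0 : 'I_n := Ordinal (ltnW n2); pose i1 : 'I_n := Ordinal n2.
(* At y = 1, t = 0 the vectors are alpha and beta, where all multiplicities are at most 1; a
   collision would need a total of n + 2. *)
have gi i j : i != j -> g 0 i != g 0 j.
  move=> ij; apply/eqP => gij; have := gd 1 0; rewrite !scale1r !scale0r !addr0 => E.
  have [a [b ab]] := conv_collision ij gij E.
  have := count_rowseq_le1 a ha; have := count_rowseq_le1 b hb; lia.
(* The solution of y g_i0 + d_i0 = y g_j + d_j. *)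
pose y j := - (d 0 i0 - d 0 j) / (g 0 i0 - g 0 j).
have coll j : i0 != j -> (y j *: g + 1 *: d) 0 i0 = (y j *: g + 1 *: d) 0 j.
  by move=> /gi ij; rewrite !mxE /y; field; rewrite subr_eq0.
have yE j : i0 != j -> y j = y i1.
  move=> ij; apply/eqP; apply: contraT => yj.
  have [a [b ab]] := conv_collision ij (coll j ij) (gd (y j) 1).
  have i01 : i0 != i1 by [].
  have [a1 [b1 ab1]] := conv_collision i01 (coll i1 i01) (gd (y i1) 1).
  have le := leq_add (count_pencil (1 *: u) a a1 ha yj) (count_pencil (1 *: v) b b1 hb yj).
  have ge := leq_add ab ab1; rewrite addnACA in ge; have := leq_trans ge le; lia.
have [|a [b [ua vb]]] := @conv_full_collision n _ _ _ i0 n2 _ (gd (y i1) 1).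
  move=> i; have [<- //|i0i] := eqVneq i0 i.
  by rewrite -(yE i i0i) coll.
(* With y = [y i1], the equation y alpha + u = a 1 reads u = (a - y mean(alpha)) 1 - y alpha°, and
   likewise for v. *)
exists (a - y i1 * mean alpha), (b - y i1 * mean beta), (- y i1).
split; apply/rowP => i.
  by have := congr1 (fun M : 'rV[R]_n => M 0 i) ua; rewrite /centered /ones !mxE; lra.
by have := congr1 (fun M : 'rV[R]_n => M 0 i) vb; rewrite /centered /ones !mxE; lra.
Qed.

(** The scale y + c t is the same for alpha and beta; the rest is a translation. *)
Lemma pencil_centered n (alpha : 'rV[R]_n) (a c : R) :
  rowseq (pencil alpha (a *: ones + c *: centered alpha)) =
  map (+%R (mean alpha *: vary R + a *: vart R))
    (map ( *:%R^~ (vary R + c *: vart R)) (rowseq (centered alpha))).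
Proof.
rewrite /rowseq -!map_comp; apply: eq_map => i; rewrite /= !mxE !mulr1.
rewrite -!mul_mpolyC !(mpolyCD, mpolyCN, mpolyCM); ring.
Qed.

Lemma form_splits_linear n (alpha beta : 'rV[R]_n) (a b c : R) :
  splits_linear n (hform alpha beta (a *: ones + c *: centered alpha)
    (b *: ones + c *: centered beta)).
Proof.
rewrite hform_perm_sum !pencil_centered perm_sum_shift perm_sum_homogenize.
have st : size (rowseq (centered alpha)) = size (rowseq (centered beta)).
  by rewrite !size_rowseq.
have [r rE rn] := conv_splits st.
have := perm_sum_polyX st; rewrite rE !size_rowseq in rn * => pE.
set x := _ - _ - _; set S := _ + c *: _.
have var1 (i : 'I_3) : ('X_i : {mpoly R[3]}) \is 1.-homog by rewrite dhomogX; apply/eqP/mdeg1.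
have x1 : x \is 1.-homog by rewrite !rpredB ?rpredD ?rpredZ //; exact: var1.
have S1 : S \is 1.-homog by rewrite rpredD ?rpredZ //; exact: var1.
(* What remains after translation is the homogenization, in x and S = y + c t, of the convolution of
   the two centered polynomials, whose roots r are real. *)
exists (fun i => x - r`_i *: S); split=> [i|]; first by rewrite rpredB ?rpredZ.
by rewrite -homogenizeZ pE -{1}rn homogenize_prodX (big_nth 0) rn big_mkord.
Qed.

End Main.

Theorem theorem1p2 (R : realType) (n : nat) (alpha beta u v : 'rV[R]_n)
  (hn : (2 <= n)%N)
  (halpha : injective (fun i : 'I_n => alpha 0 i))
  (hbeta : injective (fun i : 'I_n => beta 0 i)) :
  splits_linear n (hform alpha beta u v) <->
  exists a b c : R,
    u = a *: ones + c *: centered alpha /\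
    v = b *: ones + c *: centered beta.
Proof.
split; first exact: splits_linear_form.
by move=> [a [b [c [-> ->]]]]; exact: form_splits_linear.
Qed.
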